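(* Let $A$ be a unital algebra with differential graded algebra $(\Omega,\mathrm d)$ and $E$ an $A$-bimodule. Let $(\nabla_E,\sigma_E)$ and $(\tilde\nabla_E,\tilde\sigma_E)$ be bimodule connections on $E$ and let $\mathcal J^1_E$, $\tilde{\mathcal J}^1_E$ be the corresponding first order jet bimodules, with actions $\bullet_1,\tilde\bullet_1$ and jet prolongation maps $j^1_E,\tilde j^1_E$. Then $\mathcal J^1_E\simeq\tilde{\mathcal J}^1_E$ as jet bimodules; that is, there is an $A$-bimodule isomorphism $\varphi:\mathcal J^1_E\to\tilde{\mathcal J}^1_E$ with respect to $\bullet_1$ and $\tilde\bullet_1$ such that $\varphi\circ j^1_E=\tilde j^1_E$.
   Context: Everything is over a field. $A$ is a unital algebra and $(\Omega,\mathrm d)$ is a differential graded algebra with $\Omega^0=A$, graded Leibniz rule and $\Omega$ generated by $A,\mathrm dA$. A bimodule connection on $E$ is a linear map $\nabla_E:E\to\Omega^1\otimes_AE$ together with a bimodule map $\sigma_E:E\otimes_A\Omega^1\to\Omega^1\otimes_AE$ with $\nabla_E(as)=\mathrm da\otimes s+a\nabla_Es$ and $\nabla_E(sa)=(\nabla_Es)a+\sigma_E(s\otimes\mathrm da)$. The first order jet bimodule of $(\nabla_E,\sigma_E)$ is the vector space $\mathcal J^1_E=E\oplus\Omega^1\otimes_AE$ with $j^1_E(s)=s+\nabla_Es$ and bimodule structure $a\bullet_1s=as+\mathrm da\otimes s$, $s\bullet_1a=sa+\sigma_E(s\otimes\mathrm da)$, $a\bullet_1(\omega\otimes s)=a\omega\otimes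 s$, $(\omega\otimes s)\bullet_1a=\omega\otimes sa$; $\tilde{\mathcal J}^1_E$ is defined in the same way from $(\tilde\nabla_E,\tilde\sigma_E)$. *)

(* Defs.v *)
From HB Require Import structures.
From mathcomp Require Import all_boot all_algebra generic_quotient.
From mathcomp.multinomials Require Import freeg.
From mathcomp Require Import boolp.

Set Implicit Arguments.
Unset Strict Implicit.
Unset Printing Implicit Defensive.

Import GRing.Theory.
Local Open Scope ring_scope.
Local Open Scope quotient_scope.

(* The two scalar axioms make both actions k-bilinear: see [lactZl] etc.   *)
(* below.                                                                  *)
HB.mixin Record isBimodule (k : fieldType) (A : algType k) M
    of GRing.Lmodule k M := {
  lact : A -> M -> M;
  ract : M -> A -> M;
  lactDl : forall a b m, lact (a + b) m = lact a m + lact b m;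
  lactDr : forall a m n, lact a (m + n) = lact a m + lact a n;
  lactM : forall a b m, lact (a * b) m = lact a (lact b m);
  lact_scalar : forall c m, lact c%:A m = c *: m;
  ractDr : forall m a b, ract m (a + b) = ract m a + ract m b;
  ractDl : forall m n a, ract (m + n) a = ract m a + ract n a;
  ractM : forall m a b, ract m (a * b) = ract (ract m a) b;
  ract_scalar : forall m c, ract m c%:A = c *: m;
  lractA : forall a m b, ract (lact a m) b = lact a (ract m b)
}.

#[short(type="bimodType")]
HB.structure Definition Bimodule (k : fieldType) (A : algType k) :=
  { M of isBimodule k A M & GRing.Lmodule k M }.
Arguments bimodType {k} A.

Notation "a ▷ m" := (lact a m) (at level 40, left associativity).
Notation "m ◁ a" := (ract m a) (at level 40, left associativity).

Section BimoduleTheory.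
Variables (k : fieldType) (A : algType k) (M : bimodType A).
Implicit Types (a b : A) (m n : M) (c : k).

Lemma lact1 m : (1 : A) ▷ m = m.
Proof. by rewrite -[1]scale1r lact_scalar scale1r. Qed.

Lemma ract1 m : m ◁ (1 : A) = m.
Proof. by rewrite -[1]scale1r ract_scalar scale1r. Qed.

Lemma lactZl c a m : (c *: a) ▷ m = c *: (a ▷ m).
Proof. by rewrite -mulr_algl lactM lact_scalar. Qed.

Lemma lactZr a c m : a ▷ (c *: m) = c *: (a ▷ m).
Proof. by rewrite -lact_scalar -lactM mulr_algr lactZl. Qed.

Lemma ractZr m c a : m ◁ (c *: a) = c *: (m ◁ a).
Proof. by rewrite -mulr_algr ractM ract_scalar. Qed.

Lemma ractZl c m a : (c *: m) ◁ a = c *: (m ◁ a).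
Proof. by rewrite -ract_scalar -ractM mulr_algl ractZr. Qed.

End BimoduleTheory.

Record bimodHom (k : fieldType) (A : algType k) (M N : bimodType A) := BimodHom {
  bimodHom_fun :> {linear M -> N};
  bimodHom_lact : forall (a : A) (m : M), bimodHom_fun (a ▷ m) = a ▷ bimodHom_fun m;
  bimodHom_ract : forall (m : M) (a : A), bimodHom_fun (m ◁ a) = bimodHom_fun m ◁ a
}.

(* M ⊗_A N is the free k-vector space on M * N modulo the subspace spanned *)
(* by the k-bilinearity and A-balancedness relations.                      *)
Section Tensor.
Variables (k : fieldType) (A : algType k) (M N : bimodType A).

Definition tensor_free := {freeg (M * N)%type / k}.
HB.instance Definition _ := GRing.Lmodule.on tensor_free.

Definition fgen (m : M) (n : N) : tensor_free := << (m, n) >>.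

Inductive tensor_null : tensor_free -> Prop :=
| tensor_null_Dl m m' n : tensor_null (fgen (m + m') n - (fgen m n + fgen m' n))
| tensor_null_Dr m n n' : tensor_null (fgen m (n + n') - (fgen m n + fgen m n'))
| tensor_null_Zl c m n : tensor_null (fgen (c *: m) n - c *: fgen m n)
| tensor_null_Zr c m n : tensor_null (fgen m (c *: n) - c *: fgen m n)
| tensor_null_A m (a : A) n : tensor_null (fgen (m ◁ a) n - fgen m (a ▷ n))
| tensor_null_0 : tensor_null 0
| tensor_null_lin c x y :
    tensor_null x -> tensor_null y -> tensor_null (c *: x + y).

Definition tensor_rels : {pred tensor_free} := [pred x | `[< tensor_null x >]].

Lemma tensor_relsP x : reflect (tensor_null x) (x \in tensor_rels).
Proof. exact: asboolP. Qed.

Lemma tensor_rels_zmod_closed : zmod_closed tensor_rels.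
Proof.
split; first by apply/tensor_relsP; exact: tensor_null_0.
move=> x y /tensor_relsP nx /tensor_relsP ny; apply/tensor_relsP.
by rewrite addrC -scaleN1r; apply: tensor_null_lin.
Qed.

HB.instance Definition _ :=
  GRing.isZmodClosed.Build tensor_free tensor_rels tensor_rels_zmod_closed.

Definition tensor : Type := Quotient.quot tensor_rels.
HB.instance Definition _ := GRing.Zmodule.on tensor.

Definition tensor_class (x : tensor_free) : tensor := \pi_(Quotient.quot tensor_rels) x.

Lemma tensor_classP x y : reflect (tensor_class x = tensor_class y) (x - y \in tensor_rels).
Proof. by rewrite Quotient.idealrBE; exact: eqP. Qed.

Lemma tensor_classD x y : tensor_class (x + y) = tensor_class x + tensor_class y.
Proof. exact: (raddfD (\pi_(Quotient.quot tensor_rels))). Qed.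

Definition tensor_repr (t : tensor) : tensor_free := repr (t : Quotient.quot tensor_rels).

Lemma tensor_reprK t : tensor_class (tensor_repr t) = t.
Proof. exact: reprK. Qed.

Definition tensor_scale c (t : tensor) : tensor := tensor_class (c *: tensor_repr t).

Lemma tensor_classZ c x : tensor_class (c *: x) = tensor_scale c (tensor_class x).
Proof.
apply/tensor_classP; rewrite -scalerBr; apply/tensor_relsP.
rewrite -[_ *: _]addr0; apply: tensor_null_lin (tensor_null_0).
by apply/tensor_relsP/tensor_classP; rewrite tensor_reprK.
Qed.

Lemma tensor_scaleA c c' t : tensor_scale c (tensor_scale c' t) = tensor_scale (c * c') t.
Proof. by rewrite -(tensor_reprK t) -!tensor_classZ scalerA. Qed.

Lemma tensor_scale1 : left_id 1 tensor_scale.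
Proof. by move=> t; rewrite -(tensor_reprK t) -tensor_classZ scale1r. Qed.

Lemma tensor_scaleDr : right_distributive tensor_scale +%R.
Proof.
move=> c s t; rewrite -(tensor_reprK s) -(tensor_reprK t).
by rewrite -tensor_classD -!tensor_classZ -tensor_classD scalerDr.
Qed.

Lemma tensor_scaleDl t : {morph tensor_scale^~ t : c c' / c + c'}.
Proof.
move=> c c'; rewrite -(tensor_reprK t).
by rewrite -!tensor_classZ -tensor_classD scalerDl.
Qed.

HB.instance Definition _ := GRing.Zmodule_isLmodule.Build k tensor
  tensor_scaleA tensor_scale1 tensor_scaleDr tensor_scaleDl.

Definition tens (m : M) (n : N) : tensor := tensor_class (fgen m n).

Lemma tensDl m m' n : tens (m + m') n = tens m n + tens m' n.
Proof.
by rewrite -tensor_classD; apply/tensor_classP/tensor_relsP/tensor_null_Dl.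
Qed.

Lemma tensDr m n n' : tens m (n + n') = tens m n + tens m n'.
Proof.
by rewrite -tensor_classD; apply/tensor_classP/tensor_relsP/tensor_null_Dr.
Qed.

Lemma tensZl c m n : tens (c *: m) n = c *: tens m n.
Proof.
rewrite -[RHS]/(tensor_scale c (tensor_class (fgen m n))) -tensor_classZ.
by apply/tensor_classP/tensor_relsP/tensor_null_Zl.
Qed.

Lemma tensZr c m n : tens m (c *: n) = c *: tens m n.
Proof.
rewrite -[RHS]/(tensor_scale c (tensor_class (fgen m n))) -tensor_classZ.
by apply/tensor_classP/tensor_relsP/tensor_null_Zr.
Qed.

Lemma tens_ract m (a : A) n : tens (m ◁ a) n = tens m (a ▷ n).
Proof. exact/tensor_classP/tensor_relsP/tensor_null_A. Qed.

Lemma tensor_ind (P : tensor -> Prop) :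
  (forall m n, P (tens m n)) ->
  (forall c s t, P s -> P t -> P (c *: s + t)) -> forall t, P t.
Proof.
move=> Ptens Plin.
have P0 : P 0.
  have := Plin (-1) _ _ (Ptens 0 0) (Ptens 0 0).
  by rewrite scaleN1r addNr.
move=> t; rewrite -(tensor_reprK t); move: (tensor_repr t) => x {t}.
rewrite -(freeg_sumE x).
elim: (dom x) => [|[m n] s IHs].
  rewrite big_nil; suff -> : tensor_class 0 = 0 by [].
  exact: (raddf0 (\pi_(Quotient.quot tensor_rels))).
rewrite big_cons tensor_classD.
have -> : << coeff (m, n) x *g (m, n) >> = coeff (m, n) x *: fgen m n.
  by apply/eqP/freeg_eqP=> z; rewrite [RHS]coeffZ /fgen !coeffU mul1r.
by rewrite tensor_classZ; apply: (Plin _ (tens m n)).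
Qed.

Section UniversalProperty.
Variables (V : lmodType k) (f : M -> N -> V).
Hypothesis fDl : forall m m' n, f (m + m') n = f m n + f m' n.
Hypothesis fDr : forall m n n', f m (n + n') = f m n + f m n'.
Hypothesis fZl : forall c m n, f (c *: m) n = c *: f m n.
Hypothesis fZr : forall c m n, f m (c *: n) = c *: f m n.
Hypothesis f_ract : forall m (a : A) n, f (m ◁ a) n = f m (a ▷ n).

Let g (mn : M * N) := f mn.1 mn.2.
Let free_lift : tensor_free -> V := fglift g.

Fact free_lift_zmod_morphism : zmod_morphism free_lift.
Proof. exact: lift_is_additive. Qed.

HB.instance Definition _ :=
  GRing.isZmodMorphism.Build tensor_free V free_lift free_lift_zmod_morphism.

Fact free_lift_scalable : scalable free_lift.
Proof.
move=> c x; rewrite -{2}(freeg_sumE x) -[c *: x]/(fgscale c x) /fgscale.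
rewrite !raddf_sum; apply: eq_bigr => mn _ /=.
by rewrite /free_lift !liftU scalerA.
Qed.

HB.instance Definition _ :=
  GRing.isScalable.Build k tensor_free V *:%R free_lift free_lift_scalable.

Let free_liftE m n : free_lift (fgen m n) = f m n.
Proof. by rewrite /free_lift /fgen liftU scale1r. Qed.

Definition tensor_lift (t : tensor) : V := free_lift (tensor_repr t).

Lemma tensor_lift_class x : tensor_lift (tensor_class x) = free_lift x.
Proof.
apply/eqP; rewrite -subr_eq0 -linearB; apply/eqP.
have /tensor_relsP : tensor_repr (tensor_class x) - x \in tensor_rels.
  by apply/tensor_classP; rewrite tensor_reprK.
elim=> {x}[m m' n|m n n'|c m n|c m n|m a n||c x y _ IHx _ IHy];
  rewrite ?linearB ?linearD ?linearZ ?linear0 /= ?free_liftE.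
- by rewrite fDl -opprD subrr.
- by rewrite fDr -opprD subrr.
- by rewrite fZl scalerN subrr.
- by rewrite fZr scalerN subrr.
- by rewrite f_ract subrr.
- by [].
- by rewrite IHx IHy scaler0 addr0.
Qed.

Lemma tensor_liftE m n : tensor_lift (tens m n) = f m n.
Proof. by rewrite tensor_lift_class free_liftE. Qed.

Lemma tensor_lift_linear : linear tensor_lift.
Proof.
move=> c s t; rewrite -(tensor_reprK s) -(tensor_reprK t).
rewrite -[c *: _]/(tensor_scale c _) -tensor_classZ -tensor_classD.
by rewrite !tensor_lift_class linearP.
Qed.

End UniversalProperty.
End Tensor.

Arguments tens {k A M N} m n.
Notation "m ⊗ n" := (tens m n) (at level 40, left associativity).

Section TensorBimodule.
Variables (k : fieldType) (A : algType k) (M N : bimodType A).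
Local Notation MN := (tensor M N).

Definition tensor_lact (a : A) : MN -> MN :=
  tensor_lift (fun m n => (a ▷ m) ⊗ n).
Definition tensor_ract (t : MN) (a : A) : MN :=
  tensor_lift (fun m n => m ⊗ (n ◁ a)) t.

Lemma tensor_lactE a m n : tensor_lact a (m ⊗ n) = (a ▷ m) ⊗ n.
Proof.
apply: tensor_liftE => *.
- by rewrite lactDr tensDl.
- by rewrite tensDr.
- by rewrite lactZr tensZl.
- by rewrite tensZr.
- by rewrite -lractA tens_ract.
Qed.

Lemma tensor_ractE m n a : tensor_ract (m ⊗ n) a = m ⊗ (n ◁ a).
Proof.
apply: tensor_liftE => *.
- by rewrite tensDl.
- by rewrite ractDl tensDr.
- by rewrite tensZl.
- by rewrite ractZl tensZr.
- by rewrite lractA tens_ract.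
Qed.

Lemma tensor_lact_linear a : linear (tensor_lact a).
Proof.
apply: tensor_lift_linear => *.
- by rewrite lactDr tensDl.
- by rewrite tensDr.
- by rewrite lactZr tensZl.
- by rewrite tensZr.
- by rewrite -lractA tens_ract.
Qed.

Lemma tensor_ract_linear a : linear (tensor_ract^~ a).
Proof.
apply: tensor_lift_linear => *.
- by rewrite tensDl.
- by rewrite ractDl tensDr.
- by rewrite tensZl.
- by rewrite ractZl tensZr.
- by rewrite lractA tens_ract.
Qed.

Let lactP a c s t : tensor_lact a (c *: s + t) = c *: tensor_lact a s + tensor_lact a t.
Proof. exact: tensor_lact_linear. Qed.
Let ractP a c s t : tensor_ract (c *: s + t) a = c *: tensor_ract s a + tensor_ract t a.
Proof. exact: (tensor_ract_linear a). Qed.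

Fact tensor_lactDl a b t : tensor_lact (a + b) t = tensor_lact a t + tensor_lact b t.
Proof.
elim/tensor_ind: t => [m n|c s t IHs IHt].
  by rewrite !tensor_lactE lactDl tensDl.
by rewrite !lactP IHs IHt scalerDr addrACA.
Qed.

Fact tensor_lactDr a s t : tensor_lact a (s + t) = tensor_lact a s + tensor_lact a t.
Proof. by rewrite -[s]scale1r lactP !scale1r. Qed.

Fact tensor_lactM a b t : tensor_lact (a * b) t = tensor_lact a (tensor_lact b t).
Proof.
elim/tensor_ind: t => [m n|c s t IHs IHt]; first by rewrite !tensor_lactE lactM.
by rewrite !lactP IHs IHt.
Qed.

Fact tensor_lact_scalar c t : tensor_lact c%:A t = c *: t.
Proof.
elim/tensor_ind: t => [m n|c' s t IHs IHt].
  by rewrite !tensor_lactE lact_scalar tensZl.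
by rewrite !lactP IHs IHt scalerDr !scalerA mulrC.
Qed.

Fact tensor_ractDr t a b : tensor_ract t (a + b) = tensor_ract t a + tensor_ract t b.
Proof.
elim/tensor_ind: t => [m n|c s t IHs IHt].
  by rewrite !tensor_ractE ractDr tensDr.
by rewrite !ractP IHs IHt scalerDr addrACA.
Qed.

Fact tensor_ractDl s t a : tensor_ract (s + t) a = tensor_ract s a + tensor_ract t a.
Proof. by rewrite -[s]scale1r ractP !scale1r. Qed.

Fact tensor_ractM t a b : tensor_ract t (a * b) = tensor_ract (tensor_ract t a) b.
Proof.
elim/tensor_ind: t => [m n|c s t IHs IHt]; first by rewrite !tensor_ractE ractM.
by rewrite !ractP IHs IHt.
Qed.

Fact tensor_ract_scalar t c : tensor_ract t c%:A = c *: t.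
Proof.
elim/tensor_ind: t => [m n|c' s t IHs IHt].
  by rewrite !tensor_ractE ract_scalar tensZr.
by rewrite !ractP IHs IHt scalerDr !scalerA mulrC.
Qed.

Fact tensor_lractA a t b :
  tensor_ract (tensor_lact a t) b = tensor_lact a (tensor_ract t b).
Proof.
elim/tensor_ind: t => [m n|c s t IHs IHt].
  by rewrite !(tensor_ractE, tensor_lactE).
by rewrite !(ractP, lactP) IHs IHt.
Qed.

HB.instance Definition _ := isBimodule.Build k A (tensor M N)
  tensor_lactDl tensor_lactDr tensor_lactM tensor_lact_scalar
  tensor_ractDr tensor_ractDl tensor_ractM tensor_ract_scalar tensor_lractA.

Lemma lact_tens (a : A) (m : M) (n : N) : a ▷ (m ⊗ n) = (a ▷ m) ⊗ n.
Proof. exact: tensor_lactE. Qed.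

Lemma ract_tens (m : M) (n : N) (a : A) : (m ⊗ n) ◁ a = m ⊗ (n ◁ a).
Proof. exact: tensor_ractE. Qed.

End TensorBimodule.

(* The part Omega^n of a differential graded algebra is [form Om n]; it is *)
(* A itself, by conversion, when n = 0.  Products land in degree m + n, so *)
(* laws relating propositionally equal degrees go through [gcast].         *)
Definition graded_over (k : fieldType) (A : algType k)
    (W : nat -> lmodType k) (n : nat) : lmodType k :=
  if n is n'.+1 then W n' else A.

Definition gcast (k : fieldType) (V : nat -> lmodType k) (m n : nat)
    (e : m = n) (x : V m) : V n := ecast i (V i) e x.

Record dga (k : fieldType) (A : algType k) := Dga {
  pos_form : nat -> lmodType k;
  form := graded_over A pos_form;
  wedge : forall m n, form m -> form n -> form (m + n)%N;
  diff : forall n, {linear form n -> form n.+1};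
  wedgeDl : forall m n (x x' : form m) (y : form n),
    wedge (x + x') y = wedge x y + wedge x' y;
  wedgeDr : forall m n (x : form m) (y y' : form n),
    wedge x (y + y') = wedge x y + wedge x y';
  wedgeZl : forall m n (c : k) (x : form m) (y : form n),
    wedge (c *: x) y = c *: wedge x y;
  wedgeZr : forall m n (c : k) (x : form m) (y : form n),
    wedge x (c *: y) = c *: wedge x y;
  wedgeA : forall m n p (x : form m) (y : form n) (z : form p),
    gcast (addnA m n p) (wedge x (wedge y z)) = wedge (wedge x y) z;
  wedge1l : forall n (x : form n), @wedge 0%N n (1 : A) x = x;
  wedge1r : forall n (x : form n), gcast (addn0 n) (@wedge n 0%N x (1 : A)) = x;
  wedge00 : forall a b : A, @wedge 0%N 0%N a b = a * b;
  diff_diff : forall n (x : form n), diff n.+1 (diff n x) = 0;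
  diff_wedge : forall m n (x : form m) (y : form n),
    diff (m + n)%N (wedge x y) =
    @wedge m.+1 n (diff m x) y
      + (-1) ^+ m *: gcast (addnS m n) (wedge x (diff n y));
  (* Every graded subalgebra containing A and dA is everything; closure under *)
  (* k-scaling is automatic, since scalars lie in A.                          *)
  form_generated : forall S : forall n, form n -> Prop,
    (forall a : A, S 0%N a) ->
    (forall a : A, S 1%N (diff 0 a)) ->
    (forall n (x y : form n), S n x -> S n y -> S n (x + y)) ->
    (forall m n (x : form m) (y : form n),
       S m x -> S n y -> S (m + n)%N (wedge x y)) ->
    forall n (x : form n), S n x
}.

Section OneForms.
Variables (k : fieldType) (A : algType k) (Om : dga A).

Definition Omega1 : Type := form Om 1.
HB.instance Definition _ := GRing.Lmodule.on Omega1.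

Definition dd (a : A) : Omega1 := diff Om 0 a.

Definition Omega1_lact (a : A) (w : Omega1) : Omega1 := @wedge k A Om 0 1 a w.
Definition Omega1_ract (w : Omega1) (a : A) : Omega1 := @wedge k A Om 1 0 w a.

Let gcast_id n (e : n = n) (x : form Om n) : gcast e x = x.
Proof. by rewrite (eq_irrelevance e erefl). Qed.

Fact Omega1_lactDl a b w : Omega1_lact (a + b) w = Omega1_lact a w + Omega1_lact b w.
Proof. exact: (@wedgeDl k A Om 0 1). Qed.

Fact Omega1_lactDr a w v : Omega1_lact a (w + v) = Omega1_lact a w + Omega1_lact a v.
Proof. exact: (@wedgeDr k A Om 0 1). Qed.

Fact Omega1_lactM a b w : Omega1_lact (a * b) w = Omega1_lact a (Omega1_lact b w).
Proof.
rewrite /Omega1_lact -(wedge00 Om).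
by rewrite -(@wedgeA k A Om 0 0 1) gcast_id.
Qed.

Fact Omega1_lact_scalar c w : Omega1_lact c%:A w = c *: w.
Proof.
by rewrite /Omega1_lact (@wedgeZl k A Om 0 1) (@wedge1l k A Om 1).
Qed.

Fact Omega1_ractDr w a b : Omega1_ract w (a + b) = Omega1_ract w a + Omega1_ract w b.
Proof. exact: (@wedgeDr k A Om 1 0). Qed.

Fact Omega1_ractDl w v a : Omega1_ract (w + v) a = Omega1_ract w a + Omega1_ract v a.
Proof. exact: (@wedgeDl k A Om 1 0). Qed.

Fact Omega1_ractM w a b : Omega1_ract w (a * b) = Omega1_ract (Omega1_ract w a) b.
Proof.
rewrite /Omega1_ract -(wedge00 Om).
by rewrite -(@wedgeA k A Om 1 0 0) gcast_id.
Qed.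

Fact Omega1_ract_scalar w c : Omega1_ract w c%:A = c *: w.
Proof.
rewrite /Omega1_ract (@wedgeZr k A Om 1 0) -[in RHS](@wedge1r k A Om 1 w).
by rewrite gcast_id.
Qed.

Fact Omega1_lractA a w b :
  Omega1_ract (Omega1_lact a w) b = Omega1_lact a (Omega1_ract w b).
Proof.
rewrite /Omega1_ract /Omega1_lact.
by rewrite -[LHS](@wedgeA k A Om 0 1 0) gcast_id.
Qed.

HB.instance Definition _ := isBimodule.Build k A Omega1
  Omega1_lactDl Omega1_lactDr Omega1_lactM Omega1_lact_scalar
  Omega1_ractDr Omega1_ractDl Omega1_ractM Omega1_ract_scalar Omega1_lractA.

Lemma ddD a b : dd (a + b) = dd a + dd b.
Proof. exact: (linearD (diff Om 0)). Qed.

Lemma ddZ c a : dd (c *: a) = c *: dd a.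
Proof. exact: (linearZ_LR (diff Om 0)). Qed.

Lemma ddM (a b : A) : dd (a * b) = dd a ◁ b + a ▷ dd b.
Proof.
rewrite /dd -(wedge00 Om) (@diff_wedge k A Om 0 0) expr0 scale1r.
by rewrite gcast_id.
Qed.

Lemma dd1 : dd 1 = 0.
Proof.
have := ddM 1 1; rewrite mulr1 ract1 lact1 => /eqP.
by rewrite -[X in X == _]addr0 (inj_eq (addrI _)) eq_sym => /eqP.
Qed.

End OneForms.

Record bimod_connection (k : fieldType) (A : algType k) (Om : dga A)
    (E : bimodType A) := BimodConnection {
  nabla : {linear E -> tensor (Omega1 Om) E};
  sigma : bimodHom (tensor E (Omega1 Om)) (tensor (Omega1 Om) E);
  nabla_lact : forall (a : A) (s : E), nabla (a ▷ s) = dd Om a ⊗ s + a ▷ nabla s;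
  nabla_ract : forall (s : E) (a : A),
    nabla (s ◁ a) = nabla s ◁ a + sigma (s ⊗ dd Om a)
}.

(* The underlying vector space does not mention the connection, but both   *)
(* actions depend on it; [C] is kept as a parameter so that distinct       *)
(* connections give distinct bimodules.                                    *)
Definition jet1 (k : fieldType) (A : algType k) (Om : dga A) (E : bimodType A)
  (C : bimod_connection Om E) : Type := (E * tensor (Omega1 Om) E)%type.

Section Jets.
Variables (k : fieldType) (A : algType k) (Om : dga A) (E : bimodType A).
Variable C : bimod_connection Om E.

Local Notation J := (jet1 C).

HB.instance Definition _ := GRing.Lmodule.on J.

Definition jet1_lact (a : A) (u : J) : J :=
  (a ▷ u.1, dd Om a ⊗ u.1 + a ▷ u.2).
Definition jet1_ract (u : J) (a : A) : J :=
  (u.1 ◁ a, sigma C (u.1 ⊗ dd Om a) + u.2 ◁ a).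

Fact jet1_lactDl a b u : jet1_lact (a + b) u = jet1_lact a u + jet1_lact b u.
Proof. by congr pair; rewrite lactDl // ddD tensDl addrACA. Qed.

Fact jet1_lactDr a u v : jet1_lact a (u + v) = jet1_lact a u + jet1_lact a v.
Proof. by congr pair; rewrite lactDr // tensDr addrACA. Qed.

Fact jet1_lactM a b u : jet1_lact (a * b) u = jet1_lact a (jet1_lact b u).
Proof.
congr pair; rewrite lactM //= ddM tensDl tens_ract -lact_tens.
by rewrite lactDr addrA.
Qed.

Fact jet1_lact_scalar c u : jet1_lact c%:A u = c *: u.
Proof.
case: u => s t; congr pair => /=; rewrite lact_scalar // ddZ dd1 scaler0.
by rewrite -(scale0r (0 : Omega1 Om)) tensZl scale0r add0r.
Qed.

Fact jet1_ractDr u a b : jet1_ract u (a + b) = jet1_ract u a + jet1_ract u b.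
Proof. by congr pair; rewrite ractDr // ddD tensDr linearD addrACA. Qed.

Fact jet1_ractDl u v a : jet1_ract (u + v) a = jet1_ract u a + jet1_ract v a.
Proof. by congr pair; rewrite ractDl // tensDl linearD addrACA. Qed.

Fact jet1_ractM u a b : jet1_ract u (a * b) = jet1_ract (jet1_ract u a) b.
Proof.
congr pair; rewrite ractM //= ddM tensDr linearD /= -ract_tens -tens_ract.
by rewrite bimodHom_ract ractDl addrA; congr (_ + _); rewrite addrC.
Qed.

Fact jet1_ract_scalar u c : jet1_ract u c%:A = c *: u.
Proof.
case: u => s t; congr pair => /=; rewrite ract_scalar // ddZ dd1 scaler0.
by rewrite -(scale0r (0 : Omega1 Om)) tensZr scale0r linear0 add0r.
Qed.

Fact jet1_lractA a u b : jet1_ract (jet1_lact a u) b = jet1_lact a (jet1_ract u b).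
Proof.
congr pair => /=; first exact: lractA.
by rewrite ractDl lactDr -lact_tens bimodHom_lact ract_tens lractA addrCA.
Qed.

HB.instance Definition _ := isBimodule.Build k A J
  jet1_lactDl jet1_lactDr jet1_lactM jet1_lact_scalar
  jet1_ractDr jet1_ractDl jet1_ractM jet1_ract_scalar jet1_lractA.

Definition jet_prolong (s : E) : J := (s, nabla C s).

End Jets.

(* Main.v *)
Require Import Defs.
From mathcomp Require Import all_boot all_algebra.
From HB Require Import structures.

(** Two connections on [E] differ by a left-linear map
    [D = nabla C' - nabla C], since the Leibniz term [dd a ⊗ s] is common to
    both; this accounts for compatibility with the left actions.  On the right,
    [D] fails to be linear exactly by [(sigma C' - sigma C) (s ⊗ dd a)], which is
    also exactly how the two right jet actions differ.  Hence the shear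
    [(s, t) |-> (s, t + D s)] respects both actions.  It sends
    [(s, nabla C s)] to [(s, nabla C' s)] by construction, and is inverted by
    the shear obtained by exchanging the two connections. *)

Set Implicit Arguments.
Unset Strict Implicit.
Unset Printing Implicit Defensive.

Import GRing.Theory.
Local Open Scope ring_scope.

Section ConnectionDifference.
Variables (k : fieldType) (A : algType k) (Om : dga A) (E : bimodType A).
Implicit Types (C : bimod_connection Om E) (a : A) (s : E).

Definition nabla_diff C C' s : tensor (Omega1 Om) E := nabla C' s - nabla C s.

Lemma nabla_diff_linear C C' : linear (nabla_diff C C').
Proof. by move=> c s t; rewrite /nabla_diff (linearP (nabla C)) (linearP (nabla C')) scalerBr opprD addrACA. Qed.

Lemma nabla_diff_opp C C' s : nabla_diff C' C s = - nabla_diff C C' s.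
Proof. by rewrite /nabla_diff opprB. Qed.

Lemma bimod_actN (M : bimodType A) a (m : M) :
  (a ▷ (- m) = - (a ▷ m)) * ((- m) ◁ a = - (m ◁ a)).
Proof. by rewrite -scaleN1r lactZr ractZl !scaleN1r. Qed.

Lemma nabla_diff_lact C C' a s :
  nabla_diff C C' (a ▷ s) = a ▷ nabla_diff C C' s.
Proof.
by rewrite /nabla_diff !nabla_lact lactDr bimod_actN opprD addrACA subrr add0r.
Qed.

(** [nabla_diff] is not right linear; its defect is
    [(sigma C' - sigma C) (s ⊗ dd a)].  Each [sigma] is put on the side of its
    own connection, where it is the extra term of that right jet action. *)
Lemma sigma_nabla_diff_ract C C' s a :
  sigma C (s ⊗ dd Om a) + nabla_diff C C' (s ◁ a) =
  sigma C' (s ⊗ dd Om a) + nabla_diff C C' s ◁ a.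
Proof.
rewrite /nabla_diff !nabla_ract ractDl bimod_actN.
rewrite [nabla C s ◁ a + _]addrC opprD !addrA; congr (_ - _).
by rewrite addrC -(addrA (sigma C _)) addKr addrC.
Qed.

End ConnectionDifference.

Section JetShear.
Variables (k : fieldType) (A : algType k) (Om : dga A) (E : bimodType A).
Variables C C' : bimod_connection Om E.

Definition jet1_shear (u : jet1 C) : jet1 C' :=
  (u.1, u.2 + nabla_diff C C' u.1).

Lemma jet1_shear_linear : linear jet1_shear.
Proof.
move=> c u v; apply: injective_projections => //=.
(* [u.2] is given because [nabla_diff] is itself a sum up to conversion, and
   distributivity must not split it. *)
by rewrite nabla_diff_linear (scalerDr c u.2) addrACA.
Qed.

HB.instance Definition _ :=
  GRing.isLinear.Build k (jet1 C) (jet1 C') *:%R jet1_shear jet1_shear_linear.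

Lemma jet1_shear_lact (a : A) (u : jet1 C) :
  jet1_shear (a ▷ u) = a ▷ jet1_shear u.
Proof. by congr pair => /=; rewrite nabla_diff_lact (lactDr a u.2) addrA. Qed.

Lemma jet1_shear_ract (u : jet1 C) (a : A) :
  jet1_shear (u ◁ a) = jet1_shear u ◁ a.
Proof.
congr pair => /=.
by rewrite addrAC sigma_nabla_diff_ract (ractDl u.2) addrAC addrA.
Qed.

Definition jet1_shear_hom : bimodHom (jet1 C) (jet1 C') :=
  @BimodHom k A (jet1 C) (jet1 C') jet1_shear jet1_shear_lact jet1_shear_ract.

Lemma jet1_shear_prolong (s : E) :
  jet1_shear (jet_prolong C s) = jet_prolong C' s.
Proof. by congr pair; rewrite /= addrC subrK. Qed.

End JetShear.

Lemma jet1_shearK (k : fieldType) (A : algType k) (Om : dga A)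
    (E : bimodType A) (C C' : bimod_connection Om E) :
  cancel (@jet1_shear k A Om E C C') (@jet1_shear k A Om E C' C).
Proof.
by case=> s t; rewrite /jet1_shear /= (nabla_diff_opp C C') addrK.
Qed.

Theorem lemma5p2 (k : fieldType) (A : algType k) (Om : dga A) (E : bimodType A)
    (C C' : bimod_connection Om E) :
  exists phi : bimodHom (jet1 C) (jet1 C'),
    bijective phi /\
    (forall s : E, phi (jet_prolong C s) = jet_prolong C' s).
Proof.
exists (jet1_shear_hom C C'); split; last exact: jet1_shear_prolong.
by exists (@jet1_shear k A Om E C' C); apply: jet1_shearK.
Qed.
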